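(* Let $\mathbf{A}\neq\mathbf{Ind}$ be an epireflective subcategory of $\mathbf{Top}$ and let $\mathbf{B}$ be an AD-class in $\mathbf{A}$. Suppose that at least one of the following conditions holds: (i) every space in $\mathbf{A}\cap\mathbf{Top}_0$ is Hausdorff; (ii) $\mathbf{B}\cap\mathbf{Top}_0$ contains a space $Y$ such that $P(b,Y,Z)$ holds for some $Z\in\mathbf{A}\cap\mathbf{Top}_0$ and some non-isolated point $b\in Y$ with $\{b\}$ closed in $Y$; (iii) $\mathbf{B}\cap\mathbf{Top}_0$ contains at least one space which is not locally connected. Then $\mathbf{B}$ is hereditary if and only if it is closed under the formation of those prime factors which belong to $\mathbf{A}$ (that is, $X_a\in\mathbf{B}$ whenever $X\in\mathbf{B}$, $a\in X$ and $X_a\in\mathbf{A}$).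
   Context: $\mathbf{Top}$ is the category of topological spaces and continuous maps. All subcategories are full and isomorphism-closed (so they are identified with classes of spaces), and every subcategory of $\mathbf{Top}$ is assumed to contain at least one space with at least two points. A subcategory of $\mathbf{Top}$ is epireflective in $\mathbf{Top}$ if and only if it is closed under topological products and subspaces. $\mathbf{Ind}$ is the subcategory of all indiscrete spaces; $\mathbf{Top}_0$ is the subcategory of all $T_0$-spaces. A class $\mathbf{B}\subseteq\mathbf{A}$ is an AD-class in $\mathbf{A}$ if it is additive (closed under topological sums, i.e. disjoint unions) and divisible in $\mathbf{A}$ (if $q\colon X\to Y$ is a quotient map with $X\in\mathbf{B}$ and $Y\in\mathbf{A}$, then $Y\in\mathbf{B}$). A class is hereditary if it is closed under subspaces. For a space $X$ and $a\in X$, the prime factor $X_a$ of $X$ at $a$ is the space on the same set in which all points different from $a$ are isolated and the neighborhoods of $a$ are the same as in $X$. Let $Y,Z$ be topological spaces and $b\in Y$ a point such that $\{b\}$ is closed in $Y$. One says that $P(b,Y,Z)$ holds if there exist an open local base $\mathcal{B}$ at $b$ in $Y$, a point $a\in Z$ and an open neighborhood $U_0$ of $a$ in $Z$ such that for every $V\in\mathcal{B}$ there exists a continuous map $f\colon Y\to Z$ with $f(b)=a$ and $f^{-1}(U_0)=V$. A space $X$ is locally connected if for every $x\in X$ and every open neighborhood $U$ of $x$ there is a connected open neighborhood $V\subseteq U$ of $x$. *)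

(* Defs.v *)
From HB Require Import structures.
From mathcomp Require Import all_boot.
From mathcomp Require Import all_classical.
From mathcomp Require Import topology.

Set Implicit Arguments.
Unset Strict Implicit.
Unset Printing Implicit Defensive.

Local Open Scope classical_set_scope.

(** A class of spaces stands for the full subcategory of Top on its members. *)
Definition space_class := topologicalType -> Prop.

Definition homeomorphic (X Y : topologicalType) : Prop :=
  exists (f : X -> Y) (g : Y -> X),
    [/\ continuous f, continuous g, cancel f g & cancel g f].

Definition iso_closed (A : space_class) : Prop :=
  forall X Y : topologicalType, homeomorphic X Y -> A X -> A Y.

Definition subcategory (A : space_class) : Prop :=
  iso_closed A /\ exists (X : topologicalType) (x y : X), A X /\ x <> y.

Definition indiscrete : space_class := fun X =>
  forall U : set X, open U -> U = set0 \/ U = setT.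

(** [prod_topology] is the Tychonoff product; the index may be empty, which
    gives the one-point space. *)
Definition closed_products (A : space_class) : Prop :=
  forall (I : choiceType) (X : I -> topologicalType),
    (forall i, A (X i)) -> A (prod_topology X).

(** A set [D : set X] coerced to a type carries the initial topology of the
    inclusion; the library's [subspace D] is a different space, on all of [X]. *)
Definition hereditary (A : space_class) : Prop :=
  forall (X : topologicalType) (D : set X), A X -> A (set_type D).

(** The index may be empty, which gives the empty space. *)
Definition additive (B : space_class) : Prop :=
  forall (I : choiceType) (X : I -> topologicalType),
    (forall i, B (X i)) -> B {i : I & X i}.

Definition quotient_map (X Y : topologicalType) (q : X -> Y) : Prop :=
  (forall y, exists x, q x = y) /\
  (forall U : set Y, open U <-> open (q @^-1` U)).

Definition divisible_in (A B : space_class) : Prop :=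
  forall (X Y : topologicalType) (q : X -> Y),
    quotient_map q -> B X -> A Y -> B Y.

Definition AD_class_in (A B : space_class) : Prop :=
  [/\ forall X, B X -> A X, additive B & divisible_in A B].

Definition epimorphism (X Y : topologicalType) (e : X -> Y) : Prop :=
  continuous e /\
  forall (Z : topologicalType) (g h : Y -> Z),
    continuous g -> continuous h -> g \o e = h \o e -> g = h.

Definition reflection (A : space_class) (X Y : topologicalType) (r : X -> Y)
    : Prop :=
  [/\ A Y, continuous r &
      forall (Z : topologicalType) (f : X -> Z), A Z -> continuous f ->
        exists! g : Y -> Z, continuous g /\ g \o r = f].

Definition epireflective (A : space_class) : Prop :=
  forall X : topologicalType, exists (Y : topologicalType) (r : X -> Y),
    reflection A r /\ epimorphism r.

Definition prime_factor (X : topologicalType) (a : X) : Type := X.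

Section PrimeFactor.
Variables (X : topologicalType) (a : X).

Definition prime_factor_nbhs (x : X) : set_system X :=
  if x == a then nbhs a else [set U | U x].

Lemma prime_factor_nbhs_filter x : ProperFilter (prime_factor_nbhs x).
Proof.
rewrite /prime_factor_nbhs; case: ifP => _; first exact: nbhs_pfilter.
by split; [exact | split=> // P Q PQ; exact: PQ].
Qed.

Lemma prime_factor_nbhs_singleton x U : prime_factor_nbhs x U -> U x.
Proof.
by rewrite /prime_factor_nbhs; case: ifP => // /eqP ->; exact: nbhs_singleton.
Qed.

Lemma prime_factor_nbhs_nbhs x U :
  prime_factor_nbhs x U -> prime_factor_nbhs x (prime_factor_nbhs^~ U).
Proof.
move=> xU; rewrite {1}/prime_factor_nbhs; case: ifP => [/eqP xa|//].
subst x; have aU : nbhs a U by move: xU; rewrite /prime_factor_nbhs eqxx.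
apply: filterS aU => y Uy; rewrite /prime_factor_nbhs.
by case: ifP => // _; move: xU; rewrite /prime_factor_nbhs eqxx.
Qed.

HB.instance Definition _ := Choice.on (prime_factor a).
HB.instance Definition _ := hasNbhs.Build (prime_factor a) prime_factor_nbhs.
HB.instance Definition _ := Nbhs_isNbhsTopological.Build (prime_factor a)
  prime_factor_nbhs_filter prime_factor_nbhs_singleton prime_factor_nbhs_nbhs.

End PrimeFactor.

Definition closed_prime_factors_in (A B : space_class) : Prop :=
  forall (X : topologicalType) (a : X),
    B X -> A (prime_factor a) -> B (prime_factor a).

Definition open_local_base (Y : topologicalType) (b : Y) (V : set (set Y))
    : Prop :=
  (forall W, V W -> open_nbhs b W) /\
  (forall N, nbhs b N -> exists2 W, V W & W `<=` N).

Definition propertyP (Y : topologicalType) (b : Y) (Z : topologicalType)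
    : Prop :=
  exists (Bs : set (set Y)) (a : Z) (U0 : set Z),
    [/\ open_local_base b Bs, open_nbhs a U0 &
        forall V, Bs V -> exists f : Y -> Z,
          [/\ continuous f, f b = a & f @^-1` U0 = V]].

Definition locally_connected : space_class := fun X =>
  forall (x : X) (U : set X), open_nbhs x U ->
    exists V : set X, [/\ open_nbhs x V, connected V & V `<=` U].

(** The usual characterization of epireflective subcategories of Top. *)

Lemma eq_app (S T : Type) (f g : S -> T) : f = g -> forall x, f x = g x.
Proof. by move=> ->. Qed.

Lemma epimorphism_surj (X Y : topologicalType) (e : X -> Y) :
  epimorphism e -> forall y, exists x, e x = y.
Proof.
move=> [_ epi] y; apply: contrapT => ny.
pose Z : topologicalType := initial_topology (fun _ : bool => true).
have ctsZ (h : Y -> Z) : continuous h.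
  apply/continuousP => _ [V _ <-].
  have [Vt|nVt] := pselect (V true).
    rewrite [X in open X](_ : _ = setT); first exact: openT.
    by apply/seteqP; split.
  rewrite [X in open X](_ : _ = set0); first exact: open0.
  by apply/seteqP; split.
have E : (fun z => `[< z = y >] : Z) = (fun _ => false : Z).
  apply: epi => //; apply/funext => x /=; apply/asboolP => exy.
  by apply: ny; exists x.
by have /asboolP := eq_app E y; apply.
Qed.

Lemma surj_epimorphism (X Y : topologicalType) (e : X -> Y) :
  continuous e -> (forall y, exists x, e x = y) -> epimorphism e.
Proof.
move=> ce se; split=> // Z g h _ _ gh; apply/funext => y.
by have [x <-] := se y; exact: eq_app gh x.
Qed.

Lemma initial_continuousP (X T : topologicalType) (S : choiceType) (g : S -> T)
  (f : X -> initial_topology g) : continuous (g \o f) -> continuous f.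
Proof.
by move=> /continuousP cf; apply/continuousP => _ [V oV <-]; exact: cf.
Qed.

Lemma prod_topology_continuous (I : choiceType) (K : I -> topologicalType)
  (X : topologicalType) (f : X -> prod_topology K) :
  (forall i, continuous (fun x => f x i)) -> continuous f.
Proof. by move=> cf x; apply/cvg_sup => i; apply: initial_continuousP. Qed.

Lemma continuous_comp_fun (X Y Z : topologicalType) (f : X -> Y) (g : Y -> Z) :
  continuous f -> continuous g -> continuous (g \o f).
Proof. by move=> cf cg x; apply: continuous_comp; [exact: cf | exact: cg]. Qed.

Lemma reflection_retract (A : space_class) (X Y : topologicalType)
  (r : X -> Y) (s : Y -> X) : iso_closed A ->
  reflection A r -> epimorphism r -> continuous s -> s \o r = id -> A X.
Proof.
move=> isoA [AY cr _] [_ epi] cs sr; apply: isoA AY.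
exists s, r; split=> //; last by move=> x; exact: eq_app sr x.
suff rs : r \o s = id by move=> y; exact: eq_app rs y.
apply: epi; [exact: continuous_comp_fun | by move=> x; exact: cvg_id |].
by apply/funext => x; rewrite /= (eq_app sr x : s (r x) = x).
Qed.

Section Reflection.
Variables (A : space_class) (X : topologicalType).

Record quot := Quot {
  qspace : topologicalType;
  qmap : X -> qspace;
  qA : A qspace;
  qcont : continuous qmap;
  qsurj : forall y, exists x, qmap x = y }.

(** A quotient is determined by its kernel and its initial topology on [X],
    so that set-many quotients suffice. *)
Definition qinv (q : quot) : (X -> X -> Prop) * set (set X) :=
  (fun x y => qmap q x = qmap q y, [set qmap q @^-1` U | U in open]).

Lemma qinv_factor (p q : quot) : qinv p = qinv q ->
  exists h : qspace p -> qspace q, continuous h /\ h \o qmap p = qmap q.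
Proof.
move=> [kerE opE].
have kE x y : (qmap p x = qmap p y) = (qmap q x = qmap q y).
  exact: eq_app (eq_app kerE x) y.
have [s ps] := choice (@qsurj p).
have hq : (qmap q \o s) \o qmap p = qmap q.
  by apply/funext => x /=; rewrite -kE ps.
exists (qmap q \o s); split=> //; apply/continuousP => U oU.
have [V oV VU] : [set qmap p @^-1` U | U in open] (qmap q @^-1` U).
  by rewrite opE; exists U.
rewrite (_ : _ @^-1` U = V) //; apply/funext => y.
by rewrite /= -[in RHS](ps y); exact: esym (eq_app VU (s y)).
Qed.

Lemma reflection_exists : closed_products A -> hereditary A ->
  exists (Y : topologicalType) (r : X -> Y), reflection A r /\ epimorphism r.
Proof.
move=> prodA herA.
pose I : choiceType := {classic {k | exists q, qinv q = k}}.
pose Q (i : I) : quot := projT1 (cid (projT2 (i : {k | exists q, qinv q = k}))).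
have QE i : qinv (Q i) = projT1 (i : {k | exists q, qinv q = k}).
  by rewrite /Q; case: (cid _).
pose P : topologicalType := prod_topology (fun i => qspace (Q i)).
pose e (x : X) : P := fun i => qmap (Q i) x.
have ce : continuous e by apply: prod_topology_continuous => i; exact: qcont.
pose D : set P := range e.
pose Y : topologicalType := set_type D.
pose r (x : X) : Y := SigSub (mem_set (imageT e x) : e x \in D).
have cr : continuous r by apply: initial_continuousP.
have sr (y : Y) : exists x, r x = y.
  have /set_mem [x _ xy] := valP y; exists x; exact: val_inj.
have epi := surj_epimorphism cr sr.
exists Y, r; split=> //; split=> //.
  by apply: herA; apply: prodA => i; exact: qA.
move=> Z f AZ cf.
pose E : set Z := range f.
pose f' (x : X) : set_type E := SigSub (mem_set (imageT f x) : f x \in E).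
have sf' y : exists x, f' x = y.
  have /set_mem [x _ xy] := valP y; exists x; exact: val_inj.
have cf' : continuous f' by apply: initial_continuousP.
pose q : quot := Quot (herA Z E AZ) cf' sf'.
pose i : I := exist (fun k => exists q, qinv q = k) (qinv q) (ex_intro _ q erefl).
have [h [ch hf]] := qinv_factor (QE i : qinv (Q i) = qinv q).
pose g (y : Y) : Z := set_val (h ((set_val y : P) i)).
have cg : continuous g.
  have c1 : continuous (set_val : Y -> P) by exact: initial_continuous.
  have c2 : continuous (fun z : P => z i) by exact: proj_continuous.
  have c3 : continuous (set_val : set_type E -> Z).
    exact: initial_continuous.
  exact: continuous_comp_fun (continuous_comp_fun (continuous_comp_fun c1 c2) ch) c3.
have gr : g \o r = f.
  by apply/funext => x; exact: (congr1 (@set_val Z E) (eq_app hf x)).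
exists g; split=> // g' [cg' g'r]; case: epi => _; apply=> //.
by rewrite gr g'r.
Qed.

End Reflection.

Lemma epireflectiveP (A : space_class) : iso_closed A ->
  epireflective A <-> closed_products A /\ hereditary A.
Proof.
move=> isoA; split=> [epiA|[prodA herA] X]; last exact: reflection_exists.
split=> [I K AK|X D AX].
  have [Y [r [refl epi]]] := epiA (prod_topology K).
  have [_ _ lift] := refl.
  have ex i : exists p : Y -> K i, continuous p /\ p \o r = (fun x => x i).
    have [|p [pE _]] := lift (K i) (fun x => x i) (AK i); last by exists p.
    exact: proj_continuous.
  pose p i := projT1 (cid (ex i)).
  have pE i : continuous (p i) /\ p i \o r = (fun x => x i).
    exact: projT2 (cid (ex i)).
  apply: (@reflection_retract A _ Y r (fun y i => p i y)) => //.
    by apply: prod_topology_continuous => i; have [] := pE i.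
  apply/funext => x; apply: functional_extensionality_dep => i.
  by have [_ pr] := pE i; exact: eq_app pr x.
have [Y [r [refl epi]]] := epiA (set_type D).
have [_ _ lift] := refl.
have [|g [[cg gr] _]] := lift X set_val AX; first exact: initial_continuous.
have gD y : g y \in D.
  have [x <-] := epimorphism_surj epi y.
  by rewrite (eq_app gr x : g (r x) = set_val x); exact: valP.
apply: (@reflection_retract A _ Y r (fun y => SigSub (gD y))) => //.
  exact: initial_continuousP.
by apply/funext => x; apply: val_inj; exact: eq_app gr x.
Qed.

(* Main.v *)
(** Let [S] be the two-point Sierpinski space. A space of [A] lies in [B] iff
    its topology is final for the maps from spaces of [B].

    From prime factors to subspaces: let [D] be a subspace of [X] in [B]. Pick
    one point in each class of topologically indistinguishable points of [X],
    inside [D] when possible. These points form a T0 retract [X0] of [X], so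
    [X0] is in [B]. The prime factors of [X0] are in [A]: they are T0, which
    suffices if [S] is in [A]; otherwise [X0] is T1 and they are
    zero-dimensional. Each retracts onto a prime factor of [D] meet [X0], and
    these determine the topology of [D].

    From subspaces to prime factors under (ii): glue to every point of [X] a
    copy of [Y] at [b]. Property P embeds the result into a product of spaces
    of [A]. Its subspace made of [a] and all the sets [Y \ {b}] maps onto the
    prime factor [X_a] by collapsing copies.

    Cases (i) and (iii) reduce to (ii): suppose that every neighborhood of [b]
    contains a nonempty open set whose closure misses [b]. Take a maximal
    disjoint family of such sets and collapse each one to a point, inside the
    subspace of [Y] made of their union and [b]. This yields a nondiscrete T1
    space of [B] with one non-isolated point, where the neighborhoods of that
    point are clopen, so that P holds with the discrete two-point space. Under
    (iii) such a [b] exists, as disconnected neighborhoods split. Under (i), if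
    there is none, then [a] is isolated in [X] whenever [X_a] is in [A]. *)

From HB Require Import structures.
Require Import Defs.
From mathcomp Require Import all_boot.
From mathcomp Require Import all_classical.
From mathcomp Require Import topology.

Set Implicit Arguments.
Unset Strict Implicit.
Unset Printing Implicit Defensive.

Local Open Scope classical_set_scope.

(** * Membership in an epireflective subcategory *)

Section Epireflective.
Variable A : space_class.
Hypotheses (subA : subcategory A) (epiA : epireflective A).

(** A filter formulation of "[X] is separated by, and has the initial topology
    for, its maps into spaces of [A]". *)
Lemma epireflective_initial (X : topologicalType) :
  (forall x y : X, x <> y ->
    exists (Z : topologicalType) (f : X -> Z),
      [/\ A Z, continuous f & f x <> f y]) ->
  (forall (x : X) (F : set_system X), Filter F ->
    (forall (Z : topologicalType) (f : X -> Z), A Z -> continuous f ->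
      forall V, nbhs (f x) V -> F (f @^-1` V)) ->
    forall U, nbhs x U -> F U) ->
  A X.
Proof.
move=> sepX cvgX.
have [isoA [Z0 [z0 [_ [AZ0 _]]]]] := subA.
have [prodA herA] := (epireflectiveP isoA).1 epiA.
(* One test map is chosen for each pair of points and for each pair of a point and a filter, so that
   a product over a set suffices. *)
pose I : choiceType := {classic (X * X) + (X * set_system X)}.
pose good (i : I) (g : {Z : topologicalType & X -> Z}) :=
  [/\ A (projT1 g), continuous (projT2 g) &
    match (i : (X * X) + (X * set_system X)) with
    | inl (x, y) => x <> y -> projT2 g x <> projT2 g y
    | inr (x, F) => Filter F ->
        (forall V, nbhs (projT2 g x) V -> F (projT2 g @^-1` V)) ->
        forall U, nbhs x U -> F U
    end].
have /choice[g gP] : forall i, exists g, good i g.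
  case=> [[x y]|[x F]].
    have [xy|xy] := pselect (x = y).
      by exists (existT _ Z0 (fun=> z0)); split=> //= u; exact: cvg_cst.
    by have [Z [f [? ? ?]]] := sepX x y xy; exists (existT _ Z f).
  have [[fF [Z [f [AZ cf nf]]]]|noZ] := pselect (Filter F /\
      exists (Z : topologicalType) (f : X -> Z), [/\ A Z, continuous f &
        ~ (forall V, nbhs (f x) V -> F (f @^-1` V))]).
    by exists (existT _ Z f); split.
  (* When [F] is a filter, no map refutes its convergence to [x], so [cvgX] yields it and a constant
     map serves. *)
  exists (existT _ Z0 (fun=> z0)); split=> //= [u|fF _]; first exact: cvg_cst.
  apply: cvgX => Z f AZ cf; apply: contrapT => nf.
  by apply: noZ; split=> //; exists Z, f.
pose P : topologicalType := prod_topology (fun i => projT1 (g i)).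
pose e (x : X) : P := fun i => projT2 (g i) x.
have ce : continuous e.
  by apply: prod_topology_continuous => i; have [] := gP i.
have inj_e x y : e x = e y -> x = y.
  move=> exy; apply: contrapT => xy.
  have [_ _ /(_ xy)] := gP (inl (x, y) : (X * X) + (X * set_system X)).
  by apply; exact: (congr1 (fun p : P => p _) exy).
have open_e x U : nbhs x U -> exists2 N, nbhs (e x) N & e @^-1` N `<=` U.
  (* [F] is generated by the preimages of the neighborhoods of [e x]. The coordinate chosen for
     [(x, F)] converges along it, so [F] contains the neighborhoods of [x]: [e] is an embedding. *)
  pose F : set_system X :=
    [set U | exists2 N, nbhs (e x) N & e @^-1` N `<=` U].
  have fF : Filter F.
    split; first by exists setT => //; exact: filterT.
      move=> V W [M nM MV] [N nN NW].
      by exists (M `&` N); [exact: filterI|move=> y [/MV ? /NW]].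
    by move=> V W VW [N nN NV]; exists N => //; exact: subset_trans VW.
  have [_ _] := gP (inr (x, F) : (X * X) + (X * set_system X)).
  move=> /(_ fF) cvgF; apply: cvgF => V nV.
  by exists ((fun p : P => p _) @^-1` V) => //; exact: proj_continuous.
pose s (x : X) : set_type (range e) := SigSub (mem_set (imageT e x)).
have /choice[r rP] (d : set_type (range e)) : exists x, e x = set_val d.
  by have /set_mem [x _ xd] := valP d; exists x.
have sr : cancel r s by move=> d; apply: val_inj; exact: rP.
have AR : A (set_type (range e)).
  by apply: herA; apply: prodA => i; have [] := gP i.
apply: isoA AR; exists r, s; split=> //.
- move=> d U /open_e[N nN NU].
  rewrite rP in nN.
  have cval : continuous (set_val : set_type (range e) -> P).
    exact: initial_continuous.
  have nd : nbhs d (set_val @^-1` N) by exact: cval.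
  apply: filterS nd => d' Nd'.
  by apply: NU; rewrite /= rP.
- exact: initial_continuousP.
- by move=> x; apply: inj_e; rewrite rP.
Qed.

End Epireflective.

(** * Membership in an AD-class *)

Section ADClass.
Variables A B : space_class.
Hypotheses (subB : subcategory B) (adB : AD_class_in A B).

(** A sum of set-many test spaces maps onto [T] by a quotient map: each point is hit by a constant
    map, and each set that is not open is detected by one map. *)
Lemma AD_class_final (T : topologicalType) : A T ->
  (forall U : set T,
    (forall (K : topologicalType) (f : K -> T), B K -> continuous f ->
      open (f @^-1` U)) -> open U) ->
  B T.
Proof.
move=> AT finT; have [_ [K0 [k0 [_ [BK0 _]]]]] := subB.
have [_ addB divB] := adB.
pose I : choiceType := {classic T + {U : set T | ~ open U}}.
pose good (i : I) (g : {K : topologicalType & K -> T}) :=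
  [/\ B (projT1 g), continuous (projT2 g) &
    match (i : T + {U : set T | ~ open U}) with
    | inl t => exists k, projT2 g k = t
    | inr U => ~ open (projT2 g @^-1` sval U)
    end].
have /choice[g gP] : forall i, exists g, good i g.
  case=> [t|[U nU]].
    exists (existT _ K0 (fun=> t)); split=> //=; exact: cst_continuous.
  apply: contrapT => noK; apply: (nU); apply: finT => K f BK cf.
  by apply: contrapT => nf; apply: noK; exists (existT _ K f).
pose K i := projT1 (g i).
pose q (u : {i & K i}) : T := projT2 (g (projT1 u)) (projT2 u).
apply: (divB _ _ q) AT; last by apply: addB => i; have [] := gP i.
split=> [t|U].
  have [_ _ [k <-]] := gP (inl t : T + {U : set T | ~ open U}).
  by exists (existT K _ k).
split=> [oU|/sigT_openP oU].
  apply/sigT_openP => i; have [_ ci _] := gP i; move/continuousP in ci.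
  exact: ci.
apply: contrapT => nU.
have [_ _] := gP (inr (exist _ U nU) : T + {U : set T | ~ open U}).
by apply; exact: oU.
Qed.

End ADClass.

(** * The T0 axiom and topologies with at most one non-isolated point *)

Lemma kolmogorovP {X : topologicalType} : kolmogorov_space X <->
  forall x y : X, (forall U, open U -> U x <-> U y) -> x = y.
Proof.
split=> [T0 x y xy|T0 x y /eqP xy].
  apply/eqP/negP => /negP /T0 [U] [] [/set_mem nU /set_mem Uy]; apply: Uy;
    by apply: interior_subset; apply/(xy _ (open_interior U)).
have : ~ forall U, open U -> U x <-> U y by move=> /T0.
move=> /existsNP[U /not_implyP[oU nU]]; exists U.
have [Ux|nUx] := pselect (U x); [left|right]; split; apply/mem_set.
- exact: open_nbhs_nbhs.
- by move=> Uy; apply: nU; split.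
- by apply: open_nbhs_nbhs; split=> //; apply: contrapT => nUy;
    apply: nU; split.
- by [].
Qed.

Lemma prime_factor_openP {X : topologicalType} {a : X}
  (U : set (prime_factor a)) : open U <-> (U a -> nbhs a (U : set X)).
Proof.
rewrite openE; split=> [oU Ua|aU x Ux].
  by have := oU a Ua; rewrite /interior /nbhs /= /prime_factor_nbhs eqxx.
rewrite /interior /nbhs /= /prime_factor_nbhs; case: ifP => // /eqP xa.
by apply: aU; rewrite -xa.
Qed.

(** An alias of [T] that carries a topology: the points other than [p] are isolated, and a set
    containing [p] is a neighborhood of [p] iff it belongs to [F]. *)
Definition prime_space {T : Type} (p : T) {F : set_system T} of Filter F := T.

Section PrimeSpace.
Variables (T : choiceType) (p : T) (F : set_system T) (fF : Filter F).

Definition prime_space_open : set_system T := [set U | U p -> F U].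

Lemma prime_space_openT : prime_space_open setT.
Proof. by move=> _; exact: filterT. Qed.

Lemma prime_space_openI : setI_closed prime_space_open.
Proof. by move=> U V oU oV [/oU FU /oV FV]; exact: filterI. Qed.

Lemma prime_space_open_bigU (I : Type) (f : I -> set T) :
  (forall i, prime_space_open (f i)) -> prime_space_open (\bigcup_i f i).
Proof.
move=> of_ [i _ /of_]; apply: filterS; exact: bigcup_sup.
Qed.

HB.instance Definition _ := Choice.on (prime_space p fF).
HB.instance Definition _ := isOpenTopological.Build (prime_space p fF)
  prime_space_openT prime_space_openI prime_space_open_bigU.

Lemma prime_space_openP (U : set (prime_space p fF)) : open U <-> (U p -> F U).
Proof. by []. Qed.

End PrimeSpace.

(** The open point is [true]; the closed point is [false]. *)
Definition sierpinski : topologicalType :=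
  prime_space false (globally_filter [set true]).

Lemma clopen_indicator_continuous {X : topologicalType} {V : set X} :
  clopen V -> continuous (fun x => `[< V x >]).
Proof.
move=> [oV cV] x U nU; have Ux := nbhs_singleton nU.
have [Vx|nVx] := pselect (V x).
  have : nbhs x V by exact: open_nbhs_nbhs.
  by apply: filterS => y Vy /=; rewrite (asboolT Vy) -(asboolT Vx).
have : nbhs x (~` V) by apply: open_nbhs_nbhs; split=> //; exact: closed_openC.
by apply: filterS => y Vy /=; rewrite (asboolF Vy) -(asboolF nVx).
Qed.

(** * T0 spaces that lie in [A] *)

Section Membership.
Variables A B : space_class.
Hypotheses (subA : subcategory A) (epiA : epireflective A).
Hypotheses (subB : subcategory B) (adB : AD_class_in A B).

(** The discrete two-point space embeds in the sum of two copies of a nonempty space of [B]. *)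
Lemma bool_in : A bool.
Proof.
have [_ [K0 [k0 [_ [BK0 _]]]]] := subB.
have [BA addB _] := adB.
pose f (c : bool) : {_ : bool & K0} := existT _ c k0.
have f_inj c d : f c = f d -> c = d by exact: (congr1 (@projT1 _ _)).
have cf : continuous f.
  by apply/continuousP => U _; exact: discrete_open.
have AT : A {_ : bool & K0} by apply: BA; exact: addB.
apply: (epireflective_initial subA epiA) => [c d cd|c F fF FA U nU].
  by exists {_ : bool & K0}, f; split=> // /f_inj.
apply: (filterS _ (FA _ f AT cf (existT _ c @` setT) _)).
  by move=> d [k _ /(congr1 (@projT1 _ _)) /= <-]; exact: nbhs_singleton.
by apply: existT_nbhs; exact: filterT.
Qed.

(** The indicators of clopen sets separate points and determine the topology. *)
Lemma zero_dimensional_in (X : topologicalType) : kolmogorov_space X ->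
  (forall (x : X) U, nbhs x U -> exists V, [/\ clopen V, V x & V `<=` U]) ->
  A X.
Proof.
move=> /kolmogorovP T0 zdX.
apply: (epireflective_initial subA epiA) => [x y xy|x F fF FA U nU].
  have : ~ forall U, open U -> U x <-> U y by move=> /T0.
  move=> /existsNP[U /not_implyP[oU nU]].
  have [V [clV VE]] : exists V, clopen V /\ ~ (V x <-> V y).
    have [Ux|nUx] := pselect (U x).
      have nUy : ~ U y by move=> Uy; apply: nU.
      have [|V [cV Vx VU]] := zdX x U; first exact: open_nbhs_nbhs.
      by exists V; split=> // -[/(_ Vx) /VU].
    have Uy : U y by apply: contrapT => nUy; apply: nU.
    have [|V [cV Vy VU]] := zdX y U; first exact: open_nbhs_nbhs.
    by exists V; split=> // -[_ /(_ Vy) /VU].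
  exists bool, (fun x => `[< V x >]); split; first exact: bool_in.
    exact: clopen_indicator_continuous.
  by move=> /= Vxy; apply: VE; rewrite -(asboolE (V x)) Vxy asboolE.
have [V [cV Vx VU]] := zdX x U nU.
have cVi := clopen_indicator_continuous cV.
apply: (filterS _ (FA _ _ bool_in cVi [set true] _)).
  by move=> y /= /asboolP /VU.
by apply: open_nbhs_nbhs; split; [exact: discrete_open|exact/asboolP].
Qed.

(** The points [x] and [y] form a Sierpinski subspace, with [y] its open point. *)
Lemma sierpinski_in (X : topologicalType) (x y : X) : A X ->
  (forall U, open U -> U x -> U y) -> (exists U, [/\ open U, U y & ~ U x]) ->
  A sierpinski.
Proof.
move=> AX xy [W [oW Wy nWx]].
pose f (c : sierpinski) : X := if c then y else x.
have cf : continuous f.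
  apply/continuousP => U oU; apply/prime_space_openP => Ux c ->.
  exact: xy oU Ux.
apply: (epireflective_initial subA epiA) => [c d cd|c F fF FA U nU].
  exists X, f; split=> // fcd; apply: nWx.
  by move: c d cd fcd => [] [] //= _; [move=> <-|move=> ->].
have : nbhs c (U°) by exact: nbhs_interior.
have := open_interior U => /prime_space_openP oU /nbhs_singleton Uc.
case: c Uc FA nU => Uc FA nU.
  apply: (filterS _ (FA _ f AX cf W _)); last exact: open_nbhs_nbhs.
  by move=> [] // _; exact: nbhs_singleton nU.
apply: (filterS _ (@filterT _ F fF)) => -[] _; last exact: nbhs_singleton nU.
exact: (@interior_subset sierpinski U) (oU Uc true erefl).
Qed.

(** The indicators of open sets embed a T0 space in a power of the Sierpinski space. *)
Lemma kolmogorov_in (X : topologicalType) :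
  A sierpinski -> kolmogorov_space X -> A X.
Proof.
move=> AS /kolmogorovP T0.
have cf (U : set X) : open U -> continuous (fun x => `[< U x >] : sierpinski).
  move=> oU; apply/continuousP => V oV.
  have [Vf|nVf] := pselect (V false).
    have Vt : V true by exact: oV.
    rewrite (_ : _ @^-1` V = setT); first exact: openT.
    by apply/seteqP; split=> // x _ /=; case: asboolP.
  have [Vt|nVt] := pselect (V true).
    rewrite (_ : _ @^-1` V = U) //.
    by apply/seteqP; split=> x /=; case: asboolP.
  rewrite (_ : _ @^-1` V = set0); first exact: open0.
  by apply/seteqP; split=> x //=; case: asboolP.
apply: (epireflective_initial subA epiA) => [x y xy|x F fF FA U nU].
  have : ~ forall U, open U -> U x <-> U y by move=> /T0.
  move=> /existsNP[U /not_implyP[oU nU]].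
  exists sierpinski, (fun x => `[< U x >]); split=> //; first exact: cf.
  by move=> /= Uxy; apply: nU; rewrite -(asboolE (U x)) Uxy asboolE.
apply: (filterS _ (FA _ _ AS (cf _ (open_interior U)) [set true] _)).
  by move=> y /= /asboolP; exact: interior_subset.
by apply: open_nbhs_nbhs; split; [|apply/asboolP; exact: nU].
Qed.

Lemma prime_factor_kolmogorov (X : topologicalType) (a : X) :
  kolmogorov_space (prime_factor a).
Proof.
apply/kolmogorovP => x y xy; apply: contrapT => nxy.
have o1 z : z <> a -> open ([set z] : set (prime_factor a)).
  by move=> za; apply/prime_factor_openP => /esym.
have [xa|/o1 ox] := pselect (x = a); last by apply: nxy; exact/esym/(xy _ ox).1.
have oy : open ([set y] : set (prime_factor a)).
  by apply: o1 => ya; apply: nxy; rewrite xa ya.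
exact/nxy/(xy _ oy).2.
Qed.

(** If the Sierpinski space is not in [A], each [x] other than [a] is missed by a neighborhood of
    [a]. The sets [[set x]] and the open sets containing [a] then form a clopen base of the prime
    factor. *)
Lemma prime_factor_in (X : topologicalType) (a : X) :
  kolmogorov_space X -> A X -> A (prime_factor a).
Proof.
move=> /kolmogorovP T0 AX; have [AS|nAS] := pselect (A sierpinski).
  by apply: kolmogorov_in => //; exact: prime_factor_kolmogorov.
have T1 x : x <> a -> nbhs a (~` [set x]).
  move=> xa; apply: contrapT => nx; apply: nAS.
  have ax U : open U -> U a -> U x.
    move=> oU Ua; apply: contrapT => nUx; apply: nx.
    have : nbhs a U by exact: open_nbhs_nbhs.
    by apply: filterS => y Uy; apply: contra_not nUx => <-.
  apply: (sierpinski_in AX ax).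
  apply: contrapT => noU; apply: xa; apply/esym/T0 => U oU.
  split; first exact: ax.
  by move=> Ux; apply: contrapT => nUa; apply: noU; exists U.
apply: zero_dimensional_in; first exact: prime_factor_kolmogorov.
move=> x U; rewrite nbhsE => -[V [oV Vx] VU].
have [xa|xa] := pselect (x = a).
  exists V; split=> //; split=> //; rewrite -[V]setCK; apply: open_closedC.
  by apply/prime_factor_openP; rewrite -xa => /(_ Vx).
exists [set x]; split=> //; last by move=> _ ->; exact: VU.
split; first by apply/prime_factor_openP => /esym.
rewrite -[X in closed X]setCK; apply: open_closedC.
by apply/prime_factor_openP => _; exact: T1.
Qed.

End Membership.

(** * Representatives of topologically indistinguishable points *)

Lemma kolmogorov_transversal (X : topologicalType) (D : set X) :
  exists r : X -> X, [/\ forall x U, open U -> U (r x) <-> U x,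
    forall x, r (r x) = r x, kolmogorov_space (set_type (range r)) &
    forall x, D x -> D (r x)].
Proof.
pose indist (x y : X) := forall U, open U -> U x <-> U y.
have indist_sym x y : indist x y -> indist y x.
  by move=> xy U oU; apply: iff_sym; exact: xy.
have indist_tr x y z : indist x y -> indist y z -> indist x z.
  by move=> xy yz U oU; rewrite (xy U oU); exact: yz.
(* The candidates for representing [x]: the points of its class, or only those in [D] if the class
   meets [D]. *)
pose C x : set X :=
  [set d | indist d x /\ ((exists e, D e /\ indist e x) -> D d)].
have C0 x : C x !=set0.
  have [[e [De ex]]|no] := pselect (exists e, D e /\ indist e x).
    by exists e.
  by exists x; split.
have CE x y : indist x y -> C x = C y.
  suff sub u v : indist u v -> C u `<=` C v.
    move=> xy; apply/seteqP; split; first exact: sub.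
    exact: (sub y x (indist_sym x y xy)).
  move=> uv d [du Dd]; split; first exact: indist_tr uv.
  move=> [e [De ev]]; apply: Dd; exists e; split=> //.
  by apply: indist_tr ev _; exact: indist_sym.
(* The choice is made from the set [C x] rather than from [x], so that [r] is constant on
   classes. *)
have /choice[g gP] : forall S : {S : set X | S !=set0}, exists x, sval S x.
  by move=> [S [x Sx]]; exists x.
pose r x := g (exist _ (C x) (C0 x)).
have rC x : C x (r x) by exact: gP (exist _ (C x) (C0 x)).
have rE x y : indist x y -> r x = r y.
  by move=> xy; congr g; apply: eq_exist; exact: CE.
exists r; split=> [x|x|| x Dx]; [by case: (rC x)|by apply: rE; case: (rC x)| |].
  apply/kolmogorovP => u v uv; apply: val_inj.
  have /set_mem [x _ xu] := valP u; have /set_mem [y _ yv] := valP v.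
  rewrite -xu -yv; apply: rE => U oU.
  have [rx _] := rC x; have [ry _] := rC y.
  rewrite -(rx U oU) -(ry U oU) xu yv.
  by apply: (uv (set_val @^-1` U)); exists U.
by case: (rC x) => _; apply; exists x.
Qed.

(** * From prime factors to subspaces *)

Section PrimeFactorsToSubspaces.
Variables A B : space_class.
Hypotheses (subA : subcategory A) (epiA : epireflective A).
Hypotheses (subB : subcategory B) (adB : AD_class_in A B).

Lemma hereditary_of_prime_factors : closed_prime_factors_in A B -> hereditary B.
Proof.
move=> pfB X D BX.
have [_ herA] := (epireflectiveP subA.1).1 epiA.
have [BA _ _] := adB; have AX := BA X BX.
apply: (AD_class_final subB adB); first exact: herA.
have [r [rE rr T0 rD]] := kolmogorov_transversal D.
pose X0 := set_type (range r).
pose r0 x : X0 := SigSub (mem_set (imageT r x)).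
have BX0 : B X0.
  apply: (AD_class_final subB adB); first exact: herA.
  move=> U finU.
  have cr0 : continuous r0.
    apply: initial_continuousP; apply/continuousP => V oV.
    rewrite (_ : _ @^-1` V = V) //.
    by apply/seteqP; split=> x /=; rewrite /= rE.
  exists (r0 @^-1` U); first exact: finU.
  have r0E (z : X0) : r0 (set_val z) = z.
    apply: val_inj; have /set_mem [y _ yz] := valP z.
    by change (r (val z) = val z); rewrite -yz rr.
  by apply/seteqP; split=> z; rewrite /= r0E.
move=> U finU.
(* The map sending [set_val d] to [d] and all else to [e] is continuous. *)
have satU (d e : set_type D) :
    (forall V : set X, open V -> V (set_val d) <-> V (set_val e)) -> U d -> U e.
  move=> de Ud.
  pose f x : set_type D := if pselect (x = set_val d) then d else e.
  have fd : f (set_val d) = d by rewrite /f; case: pselect.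
  have fe : f (set_val e) = e.
    by rewrite /f; case: pselect => // ed; exact/esym/val_inj.
  have fde x : f x = d \/ f x = e by rewrite /f; case: pselect; [left|right].
  have cf : continuous f.
    apply/continuousP => _ [V oV <-].
    have [Vd|nVd] := pselect (V (set_val d)).
      rewrite [X in open X](_ : _ = setT); first exact: openT.
      apply/seteqP; split=> // x _; rewrite /preimage /mkset.
      by have [->|->] := fde x; last exact/(de _ oV).
    rewrite [X in open X](_ : _ = set0); first exact: open0.
    apply/seteqP; split=> // x; rewrite /preimage /mkset.
    by have [->|-> Ve] := fde x; last exact/nVd/(de _ oV).
  have fU := finU X f BX cf.
  have : (f @^-1` U) (set_val e).
    by apply/(de _ fU); rewrite /= fd.
  by rewrite /= fe.
rewrite openE => a Ua.
pose a0 := r0 (set_val a).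
have BP : B (prime_factor a0).
  apply: pfB => //; apply: (prime_factor_in subA epiA subB adB) => //.
  exact: herA.
(* Points of [X0] outside [D] go to the representative of [a], which lies in [D]. On the prime
   factor at [a0], continuity needs checking only at [a0]. *)
pose h (x : X0) : X :=
  if pselect (D (set_val x)) then set_val x else r (set_val a).
have DrD (d : set_type D) : D (r (set_val d)).
  by apply: rD; apply/set_mem; exact: valP.
have hD x : h x \in D.
  by apply/mem_set; rewrite /h; case: pselect => // nD; exact: DrD.
pose g (x : prime_factor a0) : set_type D := SigSub (hD x).
have hr d : D d -> h (r0 d) = r d.
  by move=> Dd; rewrite /h; case: pselect => // -[]; exact: rD.
have gr (d : set_type D) : set_val (g (r0 (set_val d))) = r (set_val d).
  by apply: hr; apply/set_mem; exact: valP.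
have cg : continuous g.
  apply: initial_continuousP; apply/continuousP => V oV.
  apply/prime_factor_openP => Va.
  have {}Va : V (r (set_val a)) by rewrite -gr.
  have nV : nbhs a0 (set_val @^-1` V).
    by apply: open_nbhs_nbhs; split; [exists V|].
  apply: filterS nV => x Vx.
  suff : V (h x) by [].
  by rewrite /h; case: pselect.
have Uga0 : U (g a0).
  by apply: satU Ua => V oV; rewrite gr rE.
(* Some open [O] around [a] has all its points in [X0] sent by [g] into [U]. As [U] is saturated for
   indistinguishability, the trace of [O] on [D] lies in [U]. *)
have /prime_factor_openP /(_ Uga0) := finU _ g BP cg.
rewrite nbhsE => -[_ [[O oO <-] Oa]] OU.
have nO : nbhs a (set_val @^-1` O).
  apply: open_nbhs_nbhs; split; first by exists O.
  exact: (rE _ _ oO).1 Oa.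
apply: filterS nO => d Od.
have : U (g (r0 (set_val d))).
  by apply: OU; exact: (rE _ _ oO).2 Od.
by apply: satU => V oV; rewrite gr rE.
Qed.

End PrimeFactorsToSubspaces.

(** * Gluing a copy of a space to every point of another *)

(** [X] with a copy of [Y] glued at [b] to each of its points: the point [x] of
    [X] is the pair [(x, b)]. *)
Definition attached (X : Type) {Y : Type} (b : Y) : Type := X * Y.

Section Attached.
Variables (X Y : topologicalType) (b : Y).

(** The final topology for the inclusions of [X] and of all copies of [Y]. *)
Definition attached_open : set_system (X * Y) :=
  [set U | open [set x | U (x, b)] /\ forall x, open [set y | U (x, y)]].

Lemma attached_openT : attached_open setT.
Proof. by split=> [|x]; exact: openT. Qed.

Lemma attached_openI : setI_closed attached_open.
Proof.
move=> U V [oU oUx] [oV oVx].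
by split=> [|x]; [exact: (openI oU oV)|exact: openI (oUx x) (oVx x)].
Qed.

Lemma attached_open_bigU (I : Type) (f : I -> set (X * Y)) :
  (forall i, attached_open (f i)) -> attached_open (\bigcup_i f i).
Proof.
move=> of_; split=> [|x].
  apply: (@bigcup_open _ _ setT (fun i => [set x | f i (x, b)])) => i _.
  by case: (of_ i).
apply: (@bigcup_open _ _ setT (fun i => [set y | f i (x, y)])) => i _.
by case: (of_ i).
Qed.

HB.instance Definition _ := Choice.copy (attached X b) (X * Y)%type.
HB.instance Definition _ := isOpenTopological.Build (attached X b)
  attached_openT attached_openI attached_open_bigU.

Lemma attached_openP (U : set (attached X b)) :
  open U <-> open [set x | U (x, b)] /\ forall x, open [set y | U (x, y)].
Proof. by []. Qed.

End Attached.

(** * From subspaces to prime factors under property P *)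

Section SubspacesToPrimeFactors.
Variables A B : space_class.
Hypotheses (subA : subcategory A) (epiA : epireflective A).
Hypotheses (subB : subcategory B) (adB : AD_class_in A B).

Lemma attached_continuous (X Y Z : topologicalType) (b : Y) (z : Z)
  (f : X -> Y -> Z) : (forall x, continuous (f x)) -> (forall x, f x b = z) ->
  continuous (fun w : attached X b => f w.1 w.2).
Proof.
move=> cf fb; apply/continuousP => U oU; apply/attached_openP; split=> [|x].
  have [Uz|nUz] := pselect (U z).
    rewrite [X in open X](_ : _ = setT); first exact: openT.
    by apply/seteqP; split=> // x _; rewrite /= fb.
  rewrite [X in open X](_ : _ = set0); first exact: open0.
  by apply/seteqP; split=> // x; rewrite /= fb.
by have /continuousP/(_ U oU) := cf x.
Qed.

Lemma attached_fst_continuous (X Y : topologicalType) (b : Y) :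
  continuous (fun w : attached X b => w.1).
Proof.
apply/continuousP => U oU; apply/attached_openP; split=> // x.
have [Ux|nUx] := pselect (U x).
  rewrite [X in open X](_ : _ = setT); first exact: openT.
  by apply/seteqP; split.
rewrite [X in open X](_ : _ = set0); first exact: open0.
by apply/seteqP; split.
Qed.

Lemma attached_copy_continuous (X Y : topologicalType) (b : Y) (x : X) :
  continuous (fun w : attached X b => if pselect (w.1 = x) then w.2 else b).
Proof.
apply: (@attached_continuous _ _ _ b b
  (fun x' y => if pselect (x' = x) then y else b)).
  move=> x'; case: pselect => xx'; first by move=> y; exact: cvg_id.
  exact: cst_continuous.
by move=> x'; case: pselect.
Qed.

(** The projection to [X] and the retractions onto single copies separate points and control
    neighborhoods of points off [X]. At points of [X], maps into [Z] given by property P control all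
    copies at once. *)
Lemma attached_in (X Y Z : topologicalType) (b : Y) :
  A X -> A Y -> A Z -> closed [set b] -> propertyP b Z -> A (attached X b).
Proof.
move=> AX AY AZ clb [Bs [a [U0 [[Bs_nbhs Bs_base] [oU0 U0a] Bs_map]]]].
have copyE x y : (if pselect (x = x) then y else b) = y.
  by case: pselect.
apply: (epireflective_initial subA epiA) => [[x y] [x' y'] neq|].
  have [xx'|xx'] := pselect (x = x'); last first.
    by exists X, (fun w => w.1); split=> //; exact: attached_fst_continuous.
  exists Y, (fun w => if pselect (w.1 = x) then w.2 else b); split=> //.
    exact: attached_copy_continuous.
  by move: neq; rewrite /= -xx' !copyE => neq yy'; apply: neq; rewrite yy'.
move=> [x y] F fF FA W; rewrite nbhsE => -[O [oO Oxy] OW].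
apply: (filterS OW); have [oOb oOx] := (attached_openP O).1 oO.
have [yb|yb] := pselect (y = b); last first.
  have oV : open ([set y | O (x, y)] `&` ~` [set b]).
    by apply: openI => //; exact: closed_openC.
  have := FA _ _ AY (@attached_copy_continuous X Y b x) _
    (open_nbhs_nbhs (conj oV _)).
  rewrite /= copyE => /(_ (conj Oxy yb)); apply: filterS => -[x' y'] /=.
  by case: pselect => [xx'|nxx'] /= [Oy] //; rewrite xx'.
rewrite {}yb in Oxy FA.
(* Since [a] and [U0] do not depend on the basic set, these maps agree at [b] and glue to one
   continuous map, for which the preimage of [U0] fits into every relevant slice of [O]. *)
have /choice[f fP] x' : exists f : Y -> Z, [/\ continuous f, f b = a &
    O (x', b) -> f @^-1` U0 `<=` [set y | O (x', y)]].
  have [Ox'|nO] := pselect (O (x', b)); last first.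
    by exists (fun=> a); split=> //; exact: cst_continuous.
  have [|V BsV VO] := Bs_base [set y | O (x', y)]; first exact: open_nbhs_nbhs.
  by have [f [cf fb fV]] := Bs_map V BsV; exists f; split=> // _; rewrite fV.
have cf : continuous (fun w : attached X b => f w.1 w.2).
  by apply: (@attached_continuous _ _ _ _ a) => x'; case: (fP x').
have nG := FA _ _ AX (@attached_fst_continuous X Y b) _
  (open_nbhs_nbhs (conj oOb Oxy)).
have nU : nbhs (f x b) U0.
  by apply: open_nbhs_nbhs; split=> //; case: (fP x) => _ ->.
apply: filterS (filterI nG (FA _ _ AZ cf _ nU)) => -[x' y'] [Ox' Uf].
by have [_ _ fO] := fP x'; exact: fO.
Qed.

Lemma prime_factors_of_propertyP (Y Z : topologicalType) (b : Y) :
  hereditary B -> B Y -> A Z -> ~ isolated [set: Y] b -> closed [set b] ->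
  propertyP b Z -> closed_prime_factors_in A B.
Proof.
move=> herB BY AZ nib clb PbZ X a BX AXa.
have [BA _ _] := adB.
apply: (AD_class_final subB adB) => // U finU; apply/prime_factor_openP => Ua.
pose W : topologicalType := attached X b.
have BW : B W.
  apply: (AD_class_final subB adB).
    exact: (attached_in (BA _ BX) (BA _ BY) AZ).
  move=> O finO; apply/attached_openP; split=> [|x].
    apply: (finO X (fun x => (x, b) : W)) => //; apply/continuousP => V.
    by move=> /attached_openP[oV _].
  apply: (finO Y (fun y => (x, y) : W)) => //; apply/continuousP => V.
  by move=> /attached_openP[_]; exact.
pose D : set W := [set w | w = (a, b) \/ w.2 <> b].
pose g (w : set_type D) : prime_factor a := (set_val w).1.
have cg : continuous g.
  apply/continuousP => V /prime_factor_openP oV.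
  (* The preimage of [V] is the trace on [D] of an open set with whole copies over [G] and copies
     without [b] over the rest of [V]. This works as [D] meets [X] only in [a]. *)
  pose G : set X := interior (V : set X).
  have GV x : G x -> V x by exact: interior_subset.
  exists [set w | G w.1 \/ V w.1 /\ w.2 <> b]; last first.
    apply/seteqP; split=> d /=; first by move=> [/GV|[]].
    have /set_mem [dE|db] := valP d; last by right.
    have {dE}da : (set_val d).1 = a := congr1 fst dE.
    move=> Vd; left; have {Vd} : V (set_val d).1 := Vd.
    by rewrite da; exact: oV.
  apply/attached_openP; split=> [|x].
    rewrite (_ : mkset _ = G); first exact: open_interior.
    by apply/seteqP; split=> x /=; [move=> [//|[]]|left].
  have [Gx|nGx] := pselect (G x).
    rewrite (_ : mkset _ = setT); first exact: openT.
    by apply/seteqP; split=> // y _; left.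
  have [Vx|nVx] := pselect (V x).
    rewrite (_ : mkset _ = ~` [set b]); first exact: closed_openC.
    by apply/seteqP; split=> y /=; [move=> [//|[]]|right].
  rewrite (_ : mkset _ = set0); first exact: open0.
  by apply/seteqP; split=> y //= -[|[]].
have [O /attached_openP[oOb oOx] OU] := finU _ g (herB _ _ BW) cg.
have OD w : D w -> O w <-> U w.1.
  move=> Dw; have := congr1 (fun S : set _ => S (SigSub (mem_set Dw))) OU.
  by rewrite /preimage /= => ->.
have Oab : O (a, b) by apply/OD => //; left.
have := open_nbhs_nbhs (conj oOb Oab); apply: filterS => x Oxb.
(* If [x] is not in [U], the slice of [O] at [x] is an open neighborhood of [b] without other
   points, since those would lie in [D] and force [U x]. *)
apply: contrapT => nUx; apply: nib; split; first exact: in_setT.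
exists [set y | O (x, y)]; first exact: open_nbhs_nbhs.
rewrite setIT; apply/seteqP; split=> [y Oxy|_ -> //].
by apply: contrapT => yb; apply/nUx/(OD (x, y) _).1 => //; right.
Qed.

End SubspacesToPrimeFactors.

(** * Reduction to spaces with one non-isolated point *)

Section PrimeSpaces.
Variables A B : space_class.
Hypotheses (subA : subcategory A) (epiA : epireflective A).
Hypotheses (subB : subcategory B) (adB : AD_class_in A B) (herB : hereditary B).

(** Open sets containing [p] are clopen, so their indicators give property P with values in [bool].
    Membership in [A] is proved here, so the last hypothesis may presuppose it. *)
Lemma prime_factors_of_prime_space (T : choiceType) (p : T) (F : set_system T)
    (fF : Filter F) :
  (forall t, t <> p -> F (~` [set t])) -> ~ F [set p] ->
  (A (prime_space p fF) -> B (prime_space p fF)) ->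
  closed_prime_factors_in A B.
Proof.
move=> T1 nFp; set P : topologicalType := prime_space p fF => AB.
have openNp (U : set P) : ~ U p -> open U.
  by move=> nUp; apply/prime_space_openP => /nUp.
have clopenp (U : set P) : open U -> U p -> clopen U.
  move=> oU Up; split=> //; rewrite -[U]setCK; apply: open_closedC.
  by apply: openNp => /(_ Up).
have clopen1 (t : P) : t <> p -> clopen [set t].
  move=> tp; split; first by apply: openNp => /esym.
  rewrite -[X in closed X]setCK; apply: open_closedC.
  by apply/prime_space_openP => _; exact: T1.
have base (t : P) U : nbhs t U -> exists V, [/\ clopen V, V t & V `<=` U].
  rewrite nbhsE => -[V [oV Vt] VU]; have [tp|tp] := pselect (t = p).
    by exists V; split=> //; apply: clopenp => //; rewrite -tp.
  by exists [set t]; split=> //; [exact: clopen1|move=> _ ->; exact: VU].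
have AP : A P.
  apply: (zero_dimensional_in subA epiA subB adB) => //.
  apply/kolmogorovP => s t st.
  have [sp|/clopen1[os _]] := pselect (s = p); last first.
    exact/esym/(st _ os).1.
  have [tp|/clopen1[ot _]] := pselect (t = p); first by rewrite sp tp.
  exact/(st _ ot).2.
apply: (@prime_factors_of_propertyP A B subA epiA subB adB P bool p) => //.
- exact: AB.
- exact: (bool_in subA epiA subB adB).
- move=> [_ [V nV]]; rewrite setIT => Vp; apply: nFp; rewrite Vp in nV.
  have /prime_space_openP := open_interior ([set p] : set P).
  by move=> /(_ nV); apply: filterS; exact: interior_subset.
- rewrite -[X in closed X]setCK; apply: open_closedC; apply: openNp; exact.
- exists [set V : set P | open_nbhs (p : P) V], true, [set true]; split.
  + by split=> // N; rewrite nbhsE => -[V pV VN]; exists V.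
  + by split=> //; exact: discrete_open.
  + move=> V [oV Vp]; exists (fun x => `[< V x >]); split.
    * exact/clopen_indicator_continuous/clopenp.
    * exact/asboolP.
    * by apply/seteqP; split=> x /asboolP.
Qed.

Lemma prime_factors_of_disjoint_opens (Y : topologicalType) (b : Y) : B Y ->
  (forall N, open_nbhs b N ->
    exists W, [/\ open W, W !=set0, W `<=` N & ~ closure W b]) ->
  closed_prime_factors_in A B.
Proof.
move=> BY sepb.
pose good : set (set Y) := [set W | [/\ open W, W !=set0 & ~ closure W b]].
have [E [Egood disjE maxE]] := ex_maximal_disjoint_subcollection id good.
(* The member [W] of [E] becomes the point [W]; [set0] stands for [b], and the
   sets outside [E] are harmless isolated points. *)
pose T : choiceType := {classic set Y}.
(* The neighborhoods of [b], pushed forward by collapsing each member of [E]. *)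
pose F : set_system T := [set U | nbhs b [set y | forall W, E W -> W y -> U W]].
have fF : Filter F.
  split=> [|U V|U V UV]; rewrite /F /=.
  - exact: (filterS (fun y _ W _ _ => I) (@filterT _ (nbhs b) _)).
  - move=> FU FV; apply: filterS (filterI FU FV) => y [yU yV] W EW Wy.
    by split; [exact: yU|exact: yV].
  - by apply: filterS => y yU W EW Wy; exact/UV/yU.
apply: (@prime_factors_of_prime_space T set0 F fF).
- move=> W W0; have [EW|nEW] := pselect (E W); last first.
    rewrite /F /=; apply: (filterS _ (@filterT _ (nbhs b) _)) => y _ V EV _ VW.
    by apply: nEW; rewrite -VW.
  have [_ _ nW] := Egood W EW.
  have : nbhs b (~` closure W).
    apply: open_nbhs_nbhs; split=> //.
    by apply: closed_openC; exact: closed_closure.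
  rewrite /F /=; apply: filterS => y nWy V EV Vy VW.
  by apply/nWy/subset_closure; rewrite -VW.
- rewrite /F /= nbhsE => -[N bN NE].
  (* Otherwise [N] meets no member of [E], and [W] could be added to [E], against maximality. *)
  have [W [oW [w Ww] WN nW]] := sepb N bN.
  have disjW V : E V -> V `&` W = set0.
    move=> EV; apply/seteqP; split=> // y [Vy Wy].
    by have := Vy; rewrite (NE y (WN y Wy) V EV Vy).
  apply: (maxE (E `|` [set W])).
  + split=> [V EV|sub]; first by left.
    have := disjW W (sub W (or_intror erefl)); rewrite setIid => W0.
    by rewrite W0 in Ww.
  + by move=> V [/Egood //|->]; split=> //; exists w.
  + move=> U V [EU|->] [EV|->] //.
    * exact: disjE.
    * by rewrite disjW // => -[].
    * by rewrite setIC disjW // => -[].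
- set P : topologicalType := prime_space _ _ => AP.
  apply: (AD_class_final subB adB) => // U finU; apply/prime_space_openP => U0.
  (* [D] is in [B] by heredity, and the collapse [g] of [D] tests the openness of [U]. The point [b]
     goes to [set0], being in no member of [E]. *)
  pose D : set Y := [set y | y = b \/ exists W, E W /\ W y].
  pose g (d : set_type D) : P :=
    if pselect (exists W, E W /\ W (set_val d)) is left e
    then projT1 (cid e) else set0.
  have gW d W : E W -> W (set_val d) -> g d = W.
    move=> EW Wd; rewrite /g; case: pselect => [e|[]]; last by exists W.
    by case: cid => V /= [EV Vd]; apply: disjE => //; exists (set_val d).
  have gb d : set_val d = b -> g d = set0.
    move=> db; rewrite /g; case: pselect => // -[W [EW Wd]].
    have [_ _ nW] := Egood W EW.
    by exfalso; apply/nW/subset_closure; rewrite -db.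
  have cg : continuous g.
    apply/continuousP => V oV; rewrite openE => d Vd.
    have /set_mem [db|[W [EW Wd]]] := valP d; last first.
      have nW : nbhs d (set_val @^-1` W).
        apply: open_nbhs_nbhs; split=> //; exists W => //.
        by have [] := Egood W EW.
      apply: filterS nW => e We; rewrite /preimage /=.
      by rewrite (gW e W EW We) -(gW d W EW Wd).
    have V0 : V set0 by rewrite -(gb d db).
    have := (prime_space_openP V).1 oV V0.
    rewrite /F /= nbhsE => -[N [oN Nb] NV].
    have nN : nbhs d (set_val @^-1` N).
      apply: open_nbhs_nbhs; split; first by exists N.
      by have : N (val d) by rewrite db.
    apply: filterS nN => e Ne; rewrite /preimage /=.
    have /set_mem [eb|[W [EW We]]] := valP e; first by rewrite gb.
    by rewrite (gW e W EW We); exact: (NV _ Ne).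
  have Db : b \in D by apply/mem_set; left.
  have [O oO OU] := finU _ g (herB D BY) cg.
  have Ob : O b.
    have := congr1 (fun S : set _ => S (SigSub Db)) OU.
    by rewrite /preimage /= gb // => ->.
  have : nbhs b O by exact: open_nbhs_nbhs.
  apply: filterS => y Oy W EW Wy.
  have Dy : y \in D by apply/mem_set; right; exists W.
  have := congr1 (fun S : set _ => S (SigSub Dy)) OU.
  by rewrite /preimage /= (gW (SigSub Dy) W EW Wy) => <-.
Qed.

End PrimeSpaces.

(** * The Hausdorff and the not locally connected cases, and the equivalence *)

Lemma prime_factors_of_hausdorff (A B : space_class) :
  subcategory A -> epireflective A -> subcategory B -> AD_class_in A B ->
  (forall X : topologicalType,
    A X -> kolmogorov_space X -> hausdorff_space X) ->
  hereditary B -> closed_prime_factors_in A B.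
Proof.
move=> subA epiA subB adB T2 herB.
have [_ herA] := (epireflectiveP subA.1).1 epiA.
have [BA _ _] := adB.
have [[Y [b [BY sepb]]]|nosep] := pselect (exists (Y : topologicalType) (b : Y),
    B Y /\ forall N, open_nbhs b N ->
      exists W, [/\ open W, W !=set0, W `<=` N & ~ closure W b]).
  exact: (prime_factors_of_disjoint_opens subA epiA subB adB herB BY sepb).
move=> X a BX AXa; apply: (AD_class_final subB adB) => // U _.
apply/prime_factor_openP => Ua.
have [N [oN Na] NW] : exists2 N, open_nbhs a N &
    forall W, open W -> W !=set0 -> W `<=` N -> closure W a.
  apply: contrapT => noN; apply: nosep; exists X, a; split=> // N aN.
  apply: contrapT => noW; apply: noN; exists N => // W oW W0 WN.
  by apply: contrapT => nW; apply: noW; exists W.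
(* Then [a] is isolated in [X], so every set containing [a] is a neighborhood of [a]. *)
suff Na1 : N `<=` [set a].
  have : nbhs a N by exact: open_nbhs_nbhs.
  by apply: filterS => x /Na1 ->.
move=> y Ny; apply: contrapT => ya.
have [r [rE rr T0 _]] := kolmogorov_transversal (@setT X).
pose r0 x : set_type (range r) := SigSub (mem_set (imageT r x)).
(* If [y] is indistinguishable from [a], the prime factor at [a] is not Hausdorff. Otherwise the
   Hausdorff T0 retract separates them by [O1] and [O2], and the closure of [N]&[O2] misses [a]. *)
have [ray|ray] := pselect (r0 a = r0 y).
  have indist V : open V -> V a -> V y.
    move=> oV Va; apply/(rE y V oV).1.
    by rewrite -(congr1 set_val ray : r a = r y); exact/(rE a V oV).2.
  apply: ya; apply/esym.
  apply: (T2 (prime_factor a) AXa (@prime_factor_kolmogorov X a)).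
  move=> V V' aV yV'; exists y; split; last exact: nbhs_singleton yV'.
  have Va := nbhs_singleton (nbhs_interior aV).
  have := open_interior V => /prime_factor_openP /(_ Va).
  rewrite nbhsE => -[O [oO Oa] OV].
  exact: (@interior_subset (prime_factor a)) (OV _ (indist O oO Oa)).
have T2r : hausdorff_space (set_type (range r)).
  exact: T2 (herA _ _ (BA _ BX)) T0.
have /eqP ray' := ray.
move: T2r; rewrite open_hausdorff => /(_ _ _ ray')[[G1 G2] /=].
move=> [/set_mem a1 /set_mem y2] [[O1 oO1 O1E] [O2 oO2 O2E]] /eqP G12.
have O12 x : O1 x -> O2 x -> False.
  move=> O1x O2x.
  have : (G1 `&` G2) (r0 x).
    by rewrite -O1E -O2E; split; [exact: (rE _ _ oO1).2|exact: (rE _ _ oO2).2].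
  by rewrite G12.
have Oa : O1 a by apply/(rE _ _ oO1).1; rewrite -O1E in a1.
have Oy : O2 y by apply/(rE _ _ oO2).1; rewrite -O2E in y2.
have [] := NW (N `&` O2) (openI oN oO2) _ (@subIsetl _ _ _) O1.
- by exists y.
- exact: open_nbhs_nbhs.
- by move=> x [[_ O2x] O1x]; exact: O12 O2x.
Qed.

(** At a point of failure, small open neighborhoods split into two separated pieces; the piece
    without [b] is the required set. *)
Lemma not_locally_connected_open (Y : topologicalType) :
  ~ locally_connected Y ->
  exists b : Y, forall N, open_nbhs b N ->
    exists W, [/\ open W, W !=set0, W `<=` N & ~ closure W b].
Proof.
move=> /existsNP[b /existsNP[U /not_implyP[[oU Ub] noV]]].
exists b => N [oN Nb].
have : ~ connected (N `&` U).
  move=> cV; apply: noV; exists (N `&` U); split=> //.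
  by split=> //; exact: openI.
move=> /connectedPn[E [E0 NUE sepE]].
have oNU : open (N `&` U) by exact: openI.
have [c Ec] : exists c, E c b.
  have : (N `&` U) b by [].
  by rewrite NUE => -[]; [exists false|exists true].
have {sepE} [sep1 sep2] : closure (E c) `&` E (~~ c) = set0 /\
    E c `&` closure (E (~~ c)) = set0.
  by case: sepE => ? ?; case: (c) => //=; split; rewrite setIC.
have NUc : N `&` U = E c `|` E (~~ c).
  by rewrite NUE; case: (c) => //=; rewrite setUC.
(* The piece without [b] is open, being what remains after removing the closure of the other
   piece. *)
have EcE : E (~~ c) = (N `&` U) `&` ~` closure (E c).
  apply/seteqP; split=> y.
    move=> Ey; split; first by rewrite NUc; right.
    by move=> cy; have : (set0 : set Y) y by rewrite -sep1.
  by rewrite NUc => -[[Ey|//]] []; exact: subset_closure.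
exists (E (~~ c)); split=> //.
- rewrite EcE; apply: openI => //; apply: closed_openC; exact: closed_closure.
- by rewrite EcE => y [[]].
- by move=> cb; have : (set0 : set Y) b by rewrite -sep2.
Qed.

Theorem proposition5p7 (A B : space_class) (hA : subcategory A)
  (hAnInd : ~ (forall X : topologicalType, A X <-> indiscrete X))
  (hAepi : epireflective A)
  (hB : subcategory B) (hAD : AD_class_in A B)
  (hcond :
    (forall X : topologicalType, A X -> kolmogorov_space X -> hausdorff_space X)
    \/ (exists (Y Z : topologicalType) (b : Y),
          (B Y /\ kolmogorov_space Y) /\ (A Z /\ kolmogorov_space Z) /\
          ~ isolated [set: Y] b /\ closed [set b] /\ propertyP b Z)
    \/ (exists Y : topologicalType,
          (B Y /\ kolmogorov_space Y) /\ ~ locally_connected Y)) :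
  hereditary B <-> closed_prime_factors_in A B.
Proof.
split=> [herB|]; last exact: hereditary_of_prime_factors.
case: hcond => [T2|[|]].
- exact: prime_factors_of_hausdorff.
- move=> [Y [Z [b [[BY _] [[AZ _] [nib [clb Pb]]]]]]].
  exact: (prime_factors_of_propertyP hA hAepi hB hAD herB BY AZ nib clb Pb).
- move=> [Y [[BY _] /not_locally_connected_open[b sepb]]].
  exact: (prime_factors_of_disjoint_opens hA hAepi hB hAD herB BY sepb).
Qed.
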